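(* Let $\hat{L}$ be a finite atomic lattice, let $a_1,\ldots,a_r$ be the atoms of $\hat{L}$, and define the squarefree monomial ideal $M(L)\subset k[L]$ by $$M(L):=(x(a_1),\ldots,x(a_r)).$$ Then $LCM(M(L))\cong \hat{L}$ (as lattices).
   Context: Fix a field $k$. A finite atomic lattice $\hat L$ is a finite lattice with minimum $\hat 0$ and maximum $\hat 1$ in which every element is a join of atoms (atoms are the elements covering $\hat 0$). Its proper part is $L=\hat L\setminus\{\hat 0,\hat 1\}$. $\operatorname{mi}(L)$ denotes the set of meet-irreducible elements of $L$, i.e. elements of $L$ covered by exactly one element of $\hat L$. Put $k[L]:=k[x_l : l\in\operatorname{mi}(L)]$. For $a\in\hat L$, $x(a):=\prod_{l} x_l\in k[L]$, the product over all $l\in \operatorname{mi}(L)$ with $a\not\le l$. For a monomial ideal $I$ with minimal monomial generators $f_1,\ldots,f_r$, the lcm-lattice $LCM(I)$ is the set of least common multiples of all subsets of $\{f_1,\ldots,f_r\}$ (the empty subset giving $1$), ordered by divisibility.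
   Formalization: The lattice is additionally assumed not to have exactly two elements: for the two-element chain, L is empty and the only atom has x(a) = 1, so M(L) = (1) and LCM(M(L)) has one element, and the claim fails. *)

(* Defs.v *)
From HB Require Import structures.
From mathcomp Require Import all_boot all_order all_algebra finmap.
From mathcomp Require Export mpoly.

Set Implicit Arguments.
Unset Strict Implicit.
Unset Printing Implicit Defensive.

Import Order.Theory GRing.Theory.

Section FiniteLattices.

Context {d : Order.disp_t} {Lhat : finTBLatticeType d}.

Definition covers (x y : Lhat) : bool :=
  (x < y)%O && [forall z, ~~ ((x < z)%O && (z < y)%O)].

Definition atoms : {set Lhat} := [set a | covers \bot%O a].

Definition proper_part : {set Lhat} := [set~ \bot%O] :&: [set~ \top%O].

Definition meet_irreducibles : {set Lhat} :=
  [set l in proper_part | #|[set u | covers l u]| == 1%N].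

End FiniteLattices.

Arguments atoms {d} Lhat.
Arguments proper_part {d} Lhat.
Arguments meet_irreducibles {d} Lhat.

(* [Lhat] is an arbitrary finite lattice with bounds; [\bot = \top] is allowed. *)
Definition atomic_lattice {d : Order.disp_t} (Lhat : finTBLatticeType d) : Prop :=
  forall x : Lhat, exists2 A : {set Lhat},
    A \subset atoms Lhat & x = (\join_(a in A) a)%O.

Section MonomialIdeals.

Local Open Scope ring_scope.
Local Open Scope fset_scope.

Definition ideal_span (R : comNzRingType) (s : seq R) (p : R) : Prop :=
  exists c : 'I_(size s) -> R, p = \sum_i c i * s`_i.

Context {k : fieldType} {n : nat}.

Definition generated_by_monomials (I : {mpoly k[n]} -> Prop)
    (G : {fset 'X_{1..n}}) : Prop :=
  forall p : {mpoly k[n]}, I p <-> ideal_span [seq 'X_[m] | m <- G] p.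

Definition minimal_monomial_generators (I : {mpoly k[n]} -> Prop)
    (G : {fset 'X_{1..n}}) : Prop :=
  generated_by_monomials I G /\
  forall H : {fset 'X_{1..n}}, H `<` G -> ~ generated_by_monomials I H.

(* Carrier of the lcm-lattice of [I], as a set of exponent vectors (the monomial
   1 being [0%MM]); it is ordered by divisibility [lem], i.e. the
   componentwise order [(_ <= _)%MM]. A monomial ideal has exactly one set [G]
   of minimal monomial generators, so the existential only names it. *)
Definition LCM (I : {mpoly k[n]} -> Prop) (m : 'X_{1..n}) : Prop :=
  exists2 G : {fset 'X_{1..n}}, minimal_monomial_generators I G &
  exists2 S : {fset 'X_{1..n}}, S `<=` G & m = \big[@mlcm n/0%MM]_(g <- S) g.

End MonomialIdeals.

Section LatticeIsomorphism.

Context {U : Type} (le : rel U) (A : U -> Prop).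

Definition is_join_in (u v w : U) : Prop :=
  [/\ A w, le u w, le v w & forall t, A t -> le u t -> le v t -> le w t].

Definition is_meet_in (u v w : U) : Prop :=
  [/\ A w, le w u, le w v & forall t, A t -> le t u -> le t v -> le t w].

(* Joins and meets on the target side are those of the poset [(A, le)]; in an
   lcm-lattice the meet is in general not the gcd of monomials. *)
Definition lattice_isomorphism {d : Order.disp_t} {T : latticeType d}
    (f : T -> U) : Prop :=
  [/\ injective f,
      forall u, A u <-> exists x, f x = u,
      forall x y, is_join_in (f x) (f y) (f (x `|` y)%O)
    & forall x y, is_meet_in (f x) (f y) (f (x `&` y)%O)].

End LatticeIsomorphism.

Section IdealOfLattice.

Local Open Scope ring_scope.

Context (k : fieldType) {d : Order.disp_t} (Lhat : finTBLatticeType d).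

(* The variable [x_l] is ['X_i] for the index [i] with [enum_val i = l]. *)
Definition lattice_ring := {mpoly k[#|meet_irreducibles Lhat|]}.

Definition xmon (a : Lhat) : lattice_ring :=
  \prod_(i < #|meet_irreducibles Lhat| | ~~ (a <= enum_val i)%O) 'X_i.

(* Degenerate case: when [Lhat] is the two-element chain, its proper part is
   empty, its only atom [\top] has [xmon \top = 1], and so [M = (1)] has a
   one-element lcm-lattice. *)
Definition M (p : lattice_ring) : Prop :=
  ideal_span [seq xmon a | a <- enum (atoms Lhat)] p.

End IdealOfLattice.

Arguments lattice_ring k {d} Lhat.
Arguments xmon k {d Lhat} a.
Arguments M k {d} Lhat p.

(* Main.v *)
Require Import Defs.
From HB Require Import structures.
From mathcomp Require Import all_boot all_order all_algebra.
From mathcomp Require Import finmap.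

(** Send u to the exponent vector of the monomial x(u).  If u is not below v,
    then v lies below a meet-irreducible l that is not above u, namely a maximal
    element among those above v and not above u.  Hence divisibility of the
    monomials x(u) is exactly the order of the lattice, while x turns joins into
    lcms.  In particular the x(a), for a an atom, form an antichain, so they are
    the minimal generators of the ideal, and their lcms are the images of the
    joins of atoms, i.e. of all lattice elements. *)

Section IdealSpan.

Import GRing.Theory.
Local Open Scope ring_scope.

Context {R : comNzRingType}.
Implicit Types s t : seq R.

Lemma mem_ideal_span s x : x \in s -> ideal_span s x.
Proof.
move=> xs; have lt_x : (index x s < size s)%N by rewrite index_mem.
exists (fun i => (i == Ordinal lt_x)%:R).
rewrite (bigD1 (Ordinal lt_x)) //= eqxx mul1r nth_index // big1 ?addr0 //.
by move=> i /negPf->; rewrite mul0r.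
Qed.

Lemma ideal_span_lincomb n t (c x : 'I_n -> R) :
  (forall i, ideal_span t (x i)) -> ideal_span t (\sum_i c i * x i).
Proof.
move=> xt; elim/big_ind: _ => [|p q [a ->] [b ->]|i _].
- by exists (fun=> 0); rewrite big1 // => i _; rewrite mul0r.
- by exists (fun i => a i + b i); rewrite -big_split; apply: eq_bigr => i _; rewrite mulrDl.
- have [a ->] := xt i; exists (fun j => c i * a j).
  by rewrite mulr_sumr; apply: eq_bigr => j _; rewrite mulrA.
Qed.

Lemma ideal_span_sub s t p :
  {in s, forall x, ideal_span t x} -> ideal_span s p -> ideal_span t p.
Proof.
by move=> st [c ->]; apply: ideal_span_lincomb => i; apply/st/mem_nth.
Qed.

Lemma eq_ideal_span s t p : s =i t -> ideal_span s p <-> ideal_span t p.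
Proof.
move=> st; split; apply: ideal_span_sub => x xs; apply: mem_ideal_span.
  by rewrite -st.
by rewrite st.
Qed.

End IdealSpan.

Lemma mlcmA n : associative (@mlcm n).
Proof. by move=> m1 m2 m3; apply/mnmP => i; rewrite !mnmE maxnA. Qed.

(** Allows lcms over finite sets to be reindexed and reordered like any commutative big operator. *)
HB.instance Definition _ n :=
  Monoid.isComLaw.Build 'X_{1..n} 0%MM (@mlcm n) (@mlcmA n) (@mlcmC n) (@mlc0m n).

Section MonomialGenerators.

Import GRing.Theory.
Local Open Scope ring_scope.
Local Open Scope fset_scope.

Context {k : fieldType} {n : nat}.
Implicit Types (g h m : 'X_{1..n}) (G : {fset 'X_{1..n}}).

Lemma lepm_anti g h : (g <= h)%MM -> (h <= g)%MM -> g = h.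
Proof.
move=> /mnm_lepP gh /mnm_lepP hg; apply/mnmP => i.
by apply/eqP; rewrite eqn_leq gh hg.
Qed.

(** Compare coefficients at [g]: a multiple of ['X_[m]] is supported on monomials divisible by [m],
    so if no member of [s] divided [g], the coefficient 1 on the left would equal 0. *)
Lemma mem_ideal_span_mpolyX (s : seq 'X_{1..n}) g :
  ideal_span [seq 'X_[k, m] | m <- s] 'X_[g] -> exists2 h, h \in s & (h <= g)%MM.
Proof.
case=> c /(congr1 (mcoeff g)); rewrite mcoeffX eqxx raddf_sum /= => E.
apply/hasP; apply: contraT => /hasPn ns; suff: (1 == 0 :> k) by rewrite oner_eq0.
rewrite -[1]/(true%:R) E big1 // => i _.
have lt_i : (i < size s)%N by rewrite -(size_map (fun m => 'X_[k, m])) ltn_ord.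
rewrite (nth_map 0%MM) //; apply: memN_msupp_eq0.
rewrite (perm_mem (msuppMX _ _)); apply/mapP => -[m' _ def_g].
by have := ns _ (mem_nth 0%MM lt_i); rewrite def_g lem_addr.
Qed.

(** Every monomial generating set contains [G]: some [h] in it divides a given [g] in [G], and some
    [g'] in [G] divides [h]; the antichain condition gives [g' = g], hence [h = g]. Being the least
    generating set, [G] is the unique minimal one. *)
Lemma antichain_minimal_generators (I : {mpoly k[n]} -> Prop) G :
  generated_by_monomials I G ->
  {in G &, forall g h, (g <= h)%MM -> g = h} ->
  forall H, minimal_monomial_generators I H <-> H = G.
Proof.
move=> genG antiG.
have below G1 G2 : generated_by_monomials I G1 -> generated_by_monomials I G2 ->
    {in G1, forall g, exists2 h, h \in G2 & (h <= g)%MM}.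
  move=> gen1 gen2 g g1; apply: mem_ideal_span_mpolyX.
  by apply/gen2/gen1/mem_ideal_span/map_f.
have subG H : generated_by_monomials I H -> G `<=` H.
  move=> genH; apply/fsubsetP => g gG.
  have [h hH le_hg] := below _ _ genG genH g gG.
  have [g' g'G le_g'h] := below _ _ genH genG h hH.
  have eq_g' := antiG _ _ g'G gG (lepm_trans le_g'h le_hg).
  by rewrite (lepm_anti _ h _ le_hg) // -eq_g'.
move=> H; split=> [[genH minH]|->].
  have [-> //|ltGH] := eqVfproper (subG _ genH).
  by case: (minH _ ltGH).
split=> // H' ltH' /subG subGH'.
by have := fsub_proper_trans subGH' ltH'; rewrite (negPf (fproper_irrefl _)).
Qed.

End MonomialGenerators.

Section OrderIsomorphism.

Import Order.Theory.

(** Joins and meets in [A] are defined by the order alone, so an order embedding with image [A]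
    transports them. *)
Lemma order_iso_lattice_isomorphism (U : Type) (leU : rel U) (A : U -> Prop)
    (d : Order.disp_t) (T : latticeType d) (f : T -> U) :
  reflexive leU -> (forall x y, leU (f x) (f y) = (x <= y)%O) ->
  (forall u, A u <-> exists x, f x = u) -> lattice_isomorphism leU A f.
Proof.
move=> refl_leU leE imA; split=> // [x y eq_f|x y|x y].
- by apply/le_anti; rewrite -!leE eq_f refl_leU.
- split; rewrite ?leE ?leUl ?leUr //; first by apply/imA; exists (x `|` y)%O.
  by move=> _ /imA[z <-]; rewrite !leE leUx => -> ->.
- split; rewrite ?leE ?leIl ?leIr //; first by apply/imA; exists (x `&` y)%O.
  by move=> _ /imA[z <-]; rewrite !leE lexI => -> ->.
Qed.

End OrderIsomorphism.

Section AtomicLattice.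

Import Order.Theory.
Local Open Scope order_scope.

Context {d : Order.disp_t} {Lhat : finTBLatticeType d}.
Implicit Types (x y l a : Lhat).

Lemma bot_lt_atom a : a \in atoms Lhat -> \bot < a.
Proof. by rewrite inE => /andP[]. Qed.

Lemma le_atom a b : a \in atoms Lhat -> b \in atoms Lhat -> a <= b -> a = b.
Proof.
move=> aA; rewrite inE => /andP[_ /forallP/(_ a)].
by rewrite bot_lt_atom //= lt_neqAle => + le_ab; rewrite le_ab andbT negbK => /eqP.
Qed.

(* If x lies below every nonzero element then it is the only atom, which atomicity
   allows only in the two-element chain. *)
Lemma atomic_least_nonzero x : atomic_lattice Lhat ->
  x != \bot -> (forall y, y != \bot -> x <= y) -> #|Lhat| = 2.
Proof.
move=> atomic nzx min_x.
have atom_eq a : a \in atoms Lhat -> a = x.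
  move=> aA; have nza : a != \bot by rewrite -lt0x bot_lt_atom.
  apply/eqP; apply: contraT => ne_ax; move: aA; rewrite inE => /andP[_ /forallP/(_ x)].
  by rewrite lt0x nzx lt_neqAle eq_sym ne_ax min_x.
have botx y : y \in [set \bot; x].
  have [A /subsetP sA ->] := atomic y; elim/big_ind: _ => [|u v|a /sA /atom_eq->].
  - by rewrite !inE eqxx.
  - by rewrite !inE => /orP[]/eqP-> /orP[]/eqP->; rewrite ?join0x ?joinx0 ?joinxx eqxx ?orbT.
  - by rewrite !inE eqxx orbT.
rewrite -cardsT; have -> : [set: Lhat] = [set \bot; x].
  by apply/setP => y; rewrite botx inE.
by rewrite cards2 eq_sym nzx.
Qed.

Lemma exists_meet_irreducible x y : atomic_lattice Lhat -> #|Lhat| <> 2 ->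
  ~~ (x <= y) -> exists2 l, l \in meet_irreducibles Lhat & (y <= l) && ~~ (x <= l).
Proof.
move=> atomic card2 nxy.
pose P l := (y <= l) && ~~ (x <= l).
have Py : P y by rewrite /P lexx.
(* Down-sets grow strictly along the order, so an element with the largest down-set is order-maximal
   for [P]. *)
case: (arg_maxnP (fun l => #|[set z | z <= l]|) Py) => l Pl max_l.
have /andP[le_yl nxl] := Pl.
have above (z : Lhat) : l < z -> x <= z.
  move=> lt_lz; apply: contraT => nxz.
  have /max_l/= : P z by rewrite /P nxz (le_trans le_yl) // ltW.
  rewrite leqNgt proper_card //; apply/properP; split.
    by apply/subsetP => u; rewrite !inE => /le_trans; apply; apply: ltW.
  by exists z; rewrite !inE ?lexx // lt_geF.
exists l => //; rewrite !inE -andbA; apply/and3P; split.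
(* If [l] were the bottom, [above] would put [x] below every nonzero element. *)
- apply: contra_notN card2 => /eqP l0; apply: (@atomic_least_nonzero x) => //.
    by apply: contraNneq nxl => ->; rewrite le0x.
  by move=> z nz; apply: above; rewrite l0 lt0x.
- by apply: contraNneq nxl => ->; rewrite lex1.
(* Anything strictly above [l] is above [x], hence above their join, which is therefore the only
   cover of [l]. *)
- apply/cards1P; exists (l `|` x); apply/setP => u; rewrite !inE /covers.
  have lt_lx : l < l `|` x.
    by rewrite lt_neqAle leUl andbT; apply: contraNneq nxl => ->; apply: leUr.
  apply/andP/eqP => [[lt_lu /forallP/(_ (l `|` x))]|->].
    by rewrite lt_lx /= lt_neqAle leUx (ltW lt_lu) above // !andbT negbK => /eqP.
  split=> //; apply/forallP => z; apply/negP => /andP[lt_lz].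
  by rewrite lt_leAnge leUx (ltW lt_lz) (above _ lt_lz) andbF.
Qed.

Definition xexp x : 'X_{1..#|meet_irreducibles Lhat|} :=
  [multinom nat_of_bool (~~ (x <= enum_val i)%O) | i < #|meet_irreducibles Lhat|].

Lemma xmonE (k : fieldType) x : xmon k x = 'X_[xexp x].
Proof.
rewrite mpolyXE_id /xmon [LHS]big_mkcond; apply: eq_bigr => i _.
by rewrite mnmE; case: (x <= _); rewrite ?expr0 ?expr1.
Qed.

(** A join lies below [l] exactly when both terms do; on 0/1 exponents the negated conjunction is
    the maximum. *)
Lemma xexpU x y : xexp (x `|` y) = mlcm (xexp x) (xexp y).
Proof.
apply/mnmP => i; rewrite !mnmE leUx negb_and.
by case: (x <= _); case: (y <= _).
Qed.

Lemma xexp0 : xexp \bot = 0%MM.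
Proof. by apply/mnmP => i; rewrite !mnmE le0x. Qed.

Lemma xexp_join (A : {set Lhat}) :
  xexp (\join_(a in A) a) = \big[@mlcm _/0%MM]_(a in A) xexp a.
Proof. by rewrite (big_morph xexp xexpU xexp0). Qed.

Hypotheses (atomic : atomic_lattice Lhat) (card2 : #|Lhat| <> 2).

Lemma xexp_le x y : (xexp x <= xexp y)%MM = (x <= y).
Proof.
apply/mnm_lepP/idP => [le_xy|le_xy i].
  apply: contraT => /(exists_meet_irreducible _ _ atomic card2)[l lM /andP[yl nxl]].
  (* At the variable of [l] the exponents of [x] and [y] are 1 and 0, against divisibility. *)
  by have := le_xy (enum_rank_in lM l); rewrite !mnmE enum_rankK_in // yl nxl.
rewrite !mnmE; case: (boolP (y <= _)) => [/(le_trans le_xy)-> //|_].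
exact: leq_b1.
Qed.

Lemma xexp_inj : injective xexp.
Proof. by move=> x y eq_xy; apply/le_anti; rewrite -!xexp_le eq_xy lepm_refl. Qed.

Local Open Scope fset_scope.

Lemma minimal_generators_M (k : fieldType) G :
  minimal_monomial_generators (M k Lhat) G <-> G = [fset xexp a | a in atoms Lhat].
Proof.
apply: antichain_minimal_generators => [p|_ _ /imfsetP[a aA ->] /imfsetP[b bA ->]].
  apply: eq_ideal_span => q; apply/mapP/mapP => [[a aA ->]|[_ /imfsetP[a /= aA ->] ->]].
    exists (xexp a); last exact: xmonE.
    by apply/imfsetP; exists a; rewrite //= -mem_enum.
  by exists a; rewrite ?mem_enum ?xmonE.
by rewrite xexp_le => /le_atom->.
Qed.

Lemma LCM_M (k : fieldType) m : LCM (M k Lhat) m <-> exists x, xexp x = m.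
Proof.
split=> [[G /minimal_generators_M-> [S /fsubsetP sS ->]]|[x <-]].
  (* The image of [xexp] contains the generators and the monomial 1 and is closed under lcm. *)
  rewrite big_seq; elim/big_ind: _ => [|_ _ [x <-] [y <-]|_ /sS /imfsetP[a _ ->]].
  - by exists \bot; apply: xexp0.
  - by exists (x `|` y)%O; apply: xexpU.
  - by exists a.
exists [fset xexp a | a in atoms Lhat]; first exact/minimal_generators_M.
have [A /subsetP sA ->] := atomic x.
exists [fset xexp a | a in A].
  by apply/fsubsetP => _ /imfsetP[a /= /sA aA ->]; apply/imfsetP; exists a.
(* Injectivity of [xexp] turns the lcm over the image set into one indexed by [A]. *)
by rewrite xexp_join big_imfset /= => [|a b _ _ /xexp_inj //]; rewrite -big_enum.
Qed.

End AtomicLattice.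

Theorem theorem2p1 (k : fieldType) (d : Order.disp_t)
    (Lhat : finTBLatticeType d) (hatomic : atomic_lattice Lhat)
    (hcard : #|Lhat| <> 2) :
  exists f : Lhat -> 'X_{1..#|meet_irreducibles Lhat|},
    lattice_isomorphism (@lem _) (LCM (M k Lhat)) f.
Proof.
exists xexp; apply: order_iso_lattice_isomorphism.
- exact: lepm_refl.
- exact: xexp_le.
- exact: LCM_M.
Qed.
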